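(* Let $(E,\|\cdot\|_E)$ and $(W,\|\cdot\|_W)$ be real Banach spaces, $\Omega$ an open subset of $E$, $f_0,\dots,f_m:\Omega\to\mathbb{R}$ functions and $h:\Omega\to W$ a mapping. Let $\hat{x}$ be a solution of the problem $$(\mathcal{H}_1)\qquad \max f_0(x)\quad\text{subject to } x\in\Omega,\ f_i(x)\ge0\ \text{for all } i\in\{1,\dots,m\},\ h(x)=0.$$ Assume: (a) for every $i\in\{0,\dots,m\}$, $f_i$ is Lipschitz in a neighborhood of $\hat{x}$; (b) $h$ is Fréchet differentiable in a neighborhood of $\hat{x}$, the Fréchet differential $x\mapsto d_Fh(x)$ is continuous at $\hat{x}$, and $\operatorname{Im} d_Fh(\hat{x})$ is closed in $W$; (c) $\operatorname{Ker}(d_Fh(\hat{x}))$ is complemented in $E$, i.e. there is a closed subspace $E_1$ of $E$ with $E=\operatorname{Ker}(d_Fh(\hat{x}))\oplus E_1$. Then there exist $\lambda^0,\dots,\lambda^m\in\mathbb{R}_+$ and $w_0^*\in W^*$ such that: (i) $(\lambda^0,\dots,\lambda^m,w_0^* )\neq(0,\dots,0,0_{W^*})$; (ii) $\lambda^if_i(\hat{x})=0$ for all $i\in\{1,\dots,m\}$; (iii) $\sum_{i=0}^m\lambda^iD^-_Mf_i(\hat{x})(u)+\langle w_0^*,d_Fh(\hat{x})(u)\rangle\le0$ for all $u\in E$. Moreover, these multipliers can be chosen so that: if $d_Fh(\hat{x})$ is not onto, then $(\lambda^0,\dots,\lambda^m,w_0^* )=(0,\dots,0,w_0^* )$ with $w_0^*\neq0$;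 if $d_Fh(\hat{x})$ is onto, then $(\lambda^0,\dots,\lambda^m)\neq(0,\dots,0)$, and if furthermore there exists $w\in\operatorname{Ker}(d_Fh(\hat{x}))$ with $D^-_Mf_j(\hat{x})(w)>0$ for every $j\in\{i\in\{1,\dots,m\}:f_i(\hat{x})=0\}$, then one can choose $\lambda^0=1$.
   Context: For a function $f$ defined near $x$ and $u\in E$: $D^-f(x)(u):=\liminf_{t\to0^+}\frac{f(x+tu)-f(x)}{t}$ (with $D^-f(x)(0)=0$), and the modified lower Dini derivative is $D^-_Mf(x)(u):=\inf_{w\in E}\{D^-f(x)(u+w)-D^-f(x)(w)\}$. $W^*$ denotes the topological dual of $W$. *)

(* Defs.v *)
From HB Require Import structures.
From mathcomp Require Import all_boot all_order all_algebra.
From mathcomp Require Import all_classical all_reals all_analysis.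
Set Implicit Arguments. Unset Strict Implicit. Unset Printing Implicit Defensive.
Import Order.TTheory GRing.Theory Num.Theory.
Import numFieldNormedType.Exports.
Local Open Scope classical_set_scope.
Local Open Scope ring_scope.

Section Defs.
Context {R : realType}.

Definition lower_dini {E : normedModType R} (f : E -> R) (x u : E) : \bar R :=
  if u == 0 then 0%E
  else limf_einf (fun t : R => ((f (x + t *: u) - f x) / t)%:E) (0 : R)^'+.

Definition mod_lower_dini {E : normedModType R} (f : E -> R) (x u : E) : \bar R :=
  ereal_inf [set (lower_dini f x (u + w)%R - lower_dini f x w)%E | w in [set: E]].

Definition lipschitz_near {E : normedModType R} (f : E -> R) (x : E) : Prop :=
  exists2 V : set E, nbhs x V &
    exists L : R, forall y z, V y -> V z -> `|f y - f z| <= L * `|y - z|.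

(* The map y |-> d_F h(y) (into bounded linear operators with the operator
   norm) is continuous at x, written out in terms of the operator norm. *)
Definition diff_continuous_at {E W : normedModType R} (h : E -> W) (x : E) : Prop :=
  forall eps : R, 0 < eps ->
    \forall y \near x, forall u : E, `|'d h y u - 'd h x u| <= eps * `|u|.

Definition is_subspace {E : normedModType R} (S : set E) : Prop :=
  S 0 /\ (forall a : R, forall x y, S x -> S y -> S (a *: x + y)).

Definition complemented {E : normedModType R} (K : set E) : Prop :=
  exists E1 : set E, [/\ is_subspace E1, closed E1,
    (forall x, K x -> E1 x -> x = 0) &
    (forall x, exists k e, [/\ K k, E1 e & x = k + e])].

Definition is_dual {W : normedModType R} (w : W -> R) : Prop :=
  (forall (a : R) (x y : W), w (a *: x + y) = a * w x + w y) /\ continuous w.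

End Defs.

(* Main.v *)
(* If the range of A = dh(xh) is proper, Hahn-Banach separates a point from it
   and lam = 0 works. If A is onto, each phi_i = D^-_M f_i(xh) is superlinear
   and Lipschitz, and phi_i <= D^- f_i(xh). Were there u in Ker A with
   phi_i u > 0 for i = 0 and all active i, a Newton iteration (Lyusternik-Graves)
   would correct xh + t u by o(t) to a zero of h, feasible and better than xh.
   So no such u exists, and one application of Hahn-Banach in W x R^(m+1)
   yields all the multipliers at once. The iteration runs on a nonlinear
   approximate right inverse of A, provided by Baire's theorem. *)
Require Import Defs.
From HB Require Import structures.
From mathcomp Require Import all_boot all_order all_algebra.
From mathcomp Require Import all_classical all_reals all_analysis.
From mathcomp Require Import ring lra.
Set Implicit Arguments. Unset Strict Implicit. Unset Printing Implicit Defensive.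
Import Order.TTheory GRing.Theory Num.Theory.
Import numFieldNormedType.Exports.
Local Open Scope classical_set_scope.
Local Open Scope ring_scope.

(** * The Hahn-Banach theorem *)

Definition sublinear {R : realType} {V : lmodType R} (p : V -> R) : Prop :=
  (forall x y, p (x + y) <= p x + p y) /\
  (forall a x, 0 <= a -> p (a *: x) = a * p x).

Lemma sublinear0 {R : realType} {V : lmodType R} (p : V -> R) :
  sublinear p -> p 0 = 0.
Proof. by move=> [_ pZ]; rewrite -(scale0r (0 : V)) pZ// mul0r. Qed.

Lemma sublinear_geN {R : realType} {V : lmodType R} (p : V -> R) x :
  sublinear p -> - p (- x) <= p x.
Proof.
move=> sp; have [pD _] := sp; rewrite lerNl -subr_ge0 opprK addrC.
by rewrite -(sublinear0 sp) -(subrr x); exact: pD.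
Qed.

(** A common construction for the functionals fed to Hahn-Banach below. One inequality per law
    suffices: homogeneity follows by using it for [a] and for [a^-1], and at the origin
    subadditivity gives [0 <= inf (G 0)]. *)
Lemma sublinear_inf {R : realType} {V : lmodType R} (G : V -> set R) :
  (forall x, G x !=set0) -> (forall x, has_lbound (G x)) ->
  (forall x y r s, G x r -> G y s -> exists2 t, G (x + y) t & t <= r + s) ->
  (forall a x r, 0 < a -> G x r -> exists2 t, G (a *: x) t & t <= a * r) ->
  (exists2 r, G 0 r & r <= 0) ->
  sublinear (fun x => inf (G x)).
Proof.
move=> G0 Glb GD GZ [r0 Gr0 r0le0].
have infD x y : inf (G (x + y)) <= inf (G x) + inf (G y).
  rewrite -lerBlDr; apply: lb_le_inf => // r Gr.
  rewrite lerBlDr -lerBlDl; apply: lb_le_inf => // s Gs.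
  rewrite lerBlDl; have [t Gt trs] := GD _ _ _ _ Gr Gs.
  by apply: le_trans trs; exact: ge_inf.
have infZ a x : 0 < a -> inf (G (a *: x)) <= a * inf (G x).
  move=> a0; rewrite -ler_pdivrMl//; apply: lb_le_inf => // r Gr.
  rewrite ler_pdivrMl//; have [t Gt tr] := GZ _ _ _ a0 Gr.
  by apply: le_trans tr; exact: ge_inf.
split=> // a x; rewrite le_eqVlt => /predU1P[<-|a0].
  rewrite scale0r mul0r; apply/eqP; rewrite eq_le; apply/andP; split.
    by apply: le_trans r0le0; exact: ge_inf.
  by have := infD 0 0; rewrite addr0 -subr_ge0 addrK.
apply/eqP; rewrite eq_le infZ//= -ler_pdivlMl//.
apply: le_trans (infZ a^-1 (a *: x) _); last by rewrite invr_gt0.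
by rewrite scalerA mulVf ?gt_eqF// scale1r.
Qed.

(* Lowering a sublinear functional in the direction [y]; the result is linear
   along [y]. *)
Lemma sublinear_lower {R : realType} {V : lmodType R} (p : V -> R) (y : V) :
  sublinear p -> exists q : V -> R,
    [/\ sublinear q, forall x, q x <= p x & q (- y) <= - p y].
Proof.
move=> sp; have [pD pZ] := sp.
(* [t = 0] yields [q <= p], and [t = 1] at [- y] yields [p 0 - p y]. The infimum is finite since [t
   * p y = p (t *: y) <= p (x + t *: y) + p (- x)]. *)
pose G x := [set p (x + t *: y) - t * p y | t in [set t | 0 <= t]].
have Glb x : lbound (G x) (- p (- x)).
  move=> _ [t /= t0 <-]; rewrite lerBrDl -pZ// lerBlDr.
  by apply: le_trans (pD _ _); rewrite addrAC subrr add0r.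
have Gp x : G x (p x) by exists 0; rewrite ?scale0r ?addr0 ?mul0r ?subr0//=.
exists (fun x => inf (G x)); split.
- apply: sublinear_inf.
  + by move=> x; exists (p x).
  + by move=> x; exists (- p (- x)); exact: Glb.
  + move=> x z _ _ [t /= t0 <-] [s /= s0 <-].
    exists (p (x + z + (t + s) *: y) - (t + s) * p y).
      by exists (t + s) => //=; rewrite addr_ge0.
    by rewrite scalerDl mulrDl opprD [leRHS]addrACA lerD2r addrACA pD.
  + move=> a x _ a0 [t /= t0 <-].
    exists (p (a *: x + (a * t) *: y) - (a * t) * p y).
      by exists (a * t) => //=; rewrite mulr_ge0// ltW.
    by rewrite mulrBr -(pZ a (x + _) (ltW a0)) scalerDr scalerA mulrA.
  + by exists 0; rewrite // -[X in G _ X](sublinear0 sp).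
- by move=> x; apply: ge_inf => //; exists (- p (- x)); exact: Glb.
- apply: ge_inf; first by exists (- p (- - y)); exact: Glb.
  by exists 1; rewrite /= ?ler01// scale1r addNr mul1r (sublinear0 sp) add0r.
Qed.

(* A minimal element among the sublinear functionals below [p] is linear,
   since [sublinear_lower] cannot decrease it. *)
Lemma hahn_banach {R : realType} {V : lmodType R} (p : V -> R) :
  sublinear p -> exists l : V -> R,
    (forall a x y, l (a *: x + y) = a * l x + l y) /\ forall x, l x <= p x.
Proof.
move=> sp.
pose below (q : V -> R) := sublinear q /\ forall x, q x <= p x.
pose T := {q : V -> R | below q}.
(* The order is reversed, so that a maximal element for [le] is a minimal functional. *)
pose le (s t : T) := `[< forall x, sval t x <= sval s x >].
have sublT (s : T) : sublinear (sval s) by have [] := svalP s.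
have leT (s : T) x : sval s x <= p x by have [_] := svalP s.
pose p0 : T := exist below p (conj sp (fun=> lexx _)).
have chain (A : set T) : total_on A le -> exists t, forall s, A s -> le s t.
  move=> Atot; have [->|/set0P[s0 As0]] := eqVneq A set0; first by exists p0.
  pose G x := [set sval s x | s in A].
  (* Each member satisfies [s x >= - s (- x) >= - p (- x)], so the infimum along the chain is
     finite. *)
  have Glb x : lbound (G x) (- p (- x)).
    move=> _ [s As <-]; apply: le_trans (sublinear_geN _ _); last exact: sublT.
    by rewrite lerN2.
  have G0 x : G x (sval s0 x) by exists s0.
  have hlG x : has_lbound (G x) by exists (- p (- x)); exact: Glb.
  have sinf : sublinear (fun x => inf (G x)).
    apply: sublinear_inf => //.
    - by move=> x; exists (sval s0 x).
    (* Of two members of the chain, the smaller one serves for both arguments. *)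
    - move=> x y _ _ [s As <-] [t At <-].
      have [/asboolP st|/asboolP ts] := Atot _ _ As At.
      + exists (sval t (x + y)); first by exists t.
        by apply: le_trans ((sublT t).1 _ _) _; rewrite lerD2r.
      + exists (sval s (x + y)); first by exists s.
        by apply: le_trans ((sublT s).1 _ _) _; rewrite lerD2l.
    - move=> a x _ a0 [s As <-]; exists (sval s (a *: x)); first by exists s.
      by rewrite ((sublT s).2 _ _ (ltW a0)).
    - by exists (sval s0 0) => //; rewrite sublinear0.
  have lep x : inf (G x) <= p x by apply: le_trans (leT s0 x); exact: ge_inf.
  exists (exist below _ (conj sinf lep)) => s As; apply/asboolP => x /=.
  by apply: ge_inf => //; exists s.
have le_refl (s : T) : le s s by apply/asboolP.
have le_tr (r s t : T) : le r s -> le s t -> le r t.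
  move=> /asboolP rs /asboolP st; apply/asboolP => x.
  exact: le_trans (st x) (rs x).
have [l lmin] := ZL_preorder p0 le_refl le_tr chain.
exists (sval l); split; last exact: leT.
have [lD lZ] := sublT l.
(* The lowered functional [q] lies below [l], so minimality gives [l <= q], in particular
   [l (- y) <= q (- y) <= - l y]. *)
have lN y : sval l (- y) = - sval l y.
  have [q [sq ql qN]] := sublinear_lower y (sublT l).
  have qp x : q x <= p x by exact: le_trans (ql x) (leT l x).
  have /lmin/asboolP/(_ (- y))/= : le l (exist below q (conj sq qp)) by apply/asboolP.
  move=> lq; apply/eqP; rewrite eq_le (le_trans lq)//= lerNl.
  by have := sublinear_geN y (sublT l).
(* Oddness turns subadditivity at [- x] and [- y] into superadditivity. *)
have linD x y : sval l (x + y) = sval l x + sval l y.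
  apply/eqP; rewrite eq_le lD /= -[leRHS]opprK -lN lerNr !opprD -!lN.
  exact: lD.
move=> a x y; rewrite linD; congr (_ + _).
have [a0|/ltW a0] := leP 0 a; first exact: lZ.
by rewrite -[a]opprK scaleNr lN mulNr -lZ// oppr_ge0.
Qed.

Lemma linear_form0 {R : realType} {V : lmodType R} (l : V -> R) :
  (forall a x y, l (a *: x + y) = a * l x + l y) -> l 0 = 0.
Proof. by move=> /(_ (-1) 0 0); rewrite scaler0 addr0 mulN1r addNr. Qed.

Lemma linear_formN {R : realType} {V : lmodType R} (l : V -> R) x :
  (forall a x y, l (a *: x + y) = a * l x + l y) -> l (- x) = - l x.
Proof.
by move=> ll; rewrite -[- x]addr0 -scaleN1r ll (linear_form0 ll) addr0 mulN1r.
Qed.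

(** A linear minorant of [p] lowered along [y] satisfies [l (- y) <= - p y], which forces contact at
    [y]. *)
Lemma hahn_banach_eq {R : realType} {V : lmodType R} (p : V -> R) (y : V) :
  sublinear p -> exists l : V -> R,
    [/\ forall a x z, l (a *: x + z) = a * l x + l z,
        forall x, l x <= p x & l y = p y].
Proof.
move=> sp; have [q [sq qp qy]] := sublinear_lower y sp.
have [l [ll lq]] := hahn_banach sq.
have lp x : l x <= p x by exact: le_trans (lq x) (qp x).
exists l; split=> //; apply/eqP; rewrite eq_le lp/= -lerN2 -linear_formN//.
exact: le_trans (lq _) qy.
Qed.

(** * Newton iteration and open mappings *)

(** The map iterated is [x - S (h x)]. The residual halves each time, so the steps are dominated by
    a geometric series of sum [rho]; completeness gives a limit, and continuity of [h] makes it a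
    zero. *)
Lemma newton_zero {R : realType} {E : completeNormedModType R}
    {W : normedModType R} (h : E -> W) (S : W -> E) (x0 : E) (C : R) :
  let rho := 2 * C * `|h x0| in
  (forall y, `|S y| <= C * `|y|) ->
  (forall x, `|x - x0| <= rho -> {for x, continuous h}) ->
  (forall x, `|x - x0| <= rho -> `|x - S (h x) - x0| <= rho ->
     2 * `|h (x - S (h x))| <= `|h x|) ->
  exists2 x, `|x - x0| <= rho & h x = 0.
Proof.
move=> rho SC hcont hdecr.
(* A negative [C] forces [h x0 = 0]. *)
have [C0|Cneg] := leP 0 C; last first.
  have S0 : `|h x0| = 0.
    apply/eqP; rewrite eq_le normr_ge0 andbT.
    by rewrite -(nmulr_rge0 _ Cneg); exact: le_trans (SC _).
  by exists x0; [rewrite subrr normr0 /rho S0 mulr0|exact/normr0_eq0].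
pose u n := iter n (fun x => x - S (h x)) x0.
have uS n : u n.+1 = u n - S (h (u n)) by [].
(* [rho * (1 - 2^-1 ^+ n)] is the partial sum of the geometric bounds on the steps; it keeps the
   iterates in the ball where the residual is known to halve. *)
have inv n : `|u n - x0| <= rho * (1 - 2^-1 ^+ n) /\
             `|h (u n)| <= 2^-1 ^+ n * `|h x0|.
  elim: n => [|n [IH1 IH2]].
    by rewrite subrr normr0 expr0 subrr mulr0 mul1r.
  have rho0 : 0 <= rho by rewrite /rho !mulr_ge0.
  have p0 k : 0 <= 2^-1 ^+ k :> R by rewrite exprn_ge0// invr_ge0.
  have step : `|u n.+1 - x0| <= rho * (1 - 2^-1 ^+ n.+1).
    rewrite uS addrAC (le_trans (ler_normB _ _))//.
    apply: (le_trans (lerD IH1 (le_trans (SC _) (ler_wpM2l C0 IH2)))).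
    by rewrite /rho exprS le_eqVlt; apply/orP; left; apply/eqP; field.
  have le_rho k : rho * (1 - 2^-1 ^+ k) <= rho.
    by rewrite ler_piMr// lerBlDr lerDl.
  split=> //; have := hdecr (u n) (le_trans IH1 (le_rho _)).
  move=> /(_ (le_trans step (le_rho _))); rewrite -uS => h2.
  by rewrite exprS -mulrA; have := le_trans h2 IH2; lra.
have usum n : series (fun k => u k.+1 - u k) n = u n - x0.
  elim: n => [|n IH]; first by rewrite /series/= big_geq// subrr.
  by rewrite seriesSr IH addrC addrA subrK.
have geo0 : `|2^-1| < 1 :> R by rewrite ger0_norm ?invr_ge0// invf_lt1 ?ltr1n.
have cvgs : cvgn (series (fun k => u k.+1 - u k)).
  apply: normed_cvg.
  apply: series_le_cvg (is_cvg_geometric_series (a := C * `|h x0|) geo0) => n.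
  - exact: normr_ge0.
  - by rewrite /geometric/= !mulr_ge0// exprn_ge0// invr_ge0.
  - rewrite /geometric/= addrAC subrr add0r normrN.
    apply: le_trans (SC _) _; rewrite -mulrA ler_wpM2l// mulrC.
    exact: (inv n).2.
have [l ul] : exists l : E, u @ \oo --> l.
  have /cvg_ex[/= l0 cvgl0] := cvgs; exists (l0 + x0).
  have -> : u = (fun n => series (fun k => u k.+1 - u k) n + x0).
    by apply/funext => n; rewrite usum subrK.
  by apply: cvgD; [exact: cvgl0|exact: cvg_cst].
have lx0 : `|l - x0| <= rho.
  have cn : (fun n => `|u n - x0|) @ \oo --> `|l - x0|.
    by apply: cvg_norm; apply: cvgB => //; exact: cvg_cst.
  rewrite -(cvg_lim _ cn)//; apply: limr_le; first by apply/cvg_ex; exists `|l - x0|.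
  apply: nearW => n; apply: le_trans (inv n).1 _.
  by rewrite ler_piMr ?lerBlDr ?lerDl ?exprn_ge0 ?invr_ge0// /rho !mulr_ge0.
exists l => //; apply/normr0_eq0.
have ch : (fun n => `|h (u n)|) @ \oo --> `|h l|.
  apply: cvg_norm; apply: continuous_cvg => //; exact: hcont.
have c0 : (fun n => `|h (u n)|) @ \oo --> (0 : R).
  apply: (squeeze_cvgr _ (cvg_cst (0 : R)) (cvg_geometric `|h x0| geo0)).
  by apply: nearW => n; rewrite normr_ge0/= /geometric/= mulrC; exact: (inv n).2.
exact: cvg_unique ch c0.
Qed.

(** The new residual splits into the linearization error, at most [eps * C * |h x| <= |h x| / 4],
    and the defect of [S] as a right inverse of [A], at most another quarter. So it halves, as
    [newton_zero] requires. *)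
Lemma graves {R : realType} {E : completeNormedModType R}
    {W : normedModType R} (h : E -> W) (A : {linear E -> W}) (S : W -> E)
    (xh : E) (C eps rho : R) :
  0 <= eps -> 4 * eps * C <= 1 ->
  (forall y, `|S y| <= C * `|y|) -> (forall y, 4 * `|A (S y) - y| <= `|y|) ->
  (forall x, `|x - xh| <= rho -> {for x, continuous h}) ->
  (forall x y, `|x - xh| <= rho -> `|y - xh| <= rho ->
     `|h x - h y - A (x - y)| <= eps * `|x - y|) ->
  forall x0, `|x0 - xh| + 2 * C * `|h x0| <= rho ->
  exists2 x, `|x - x0| <= 2 * C * `|h x0| & h x = 0.
Proof.
move=> eps0 epsC SC AS hcont hdiff x0 hx0.
have inball x : `|x - x0| <= 2 * C * `|h x0| -> `|x - xh| <= rho.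
  move=> xx0; apply: le_trans hx0; rewrite -(subrK x0 x) -addrA addrC.
  by apply: le_trans (ler_normD _ _) _; rewrite lerD2l.
apply: (@newton_zero _ _ _ _ S) => //.
  by move=> x /inball; exact: hcont.
move=> x /inball xr /inball x'r.
set x' := x - S (h x) in x'r *.
have dx : x' - x = - S (h x) by rewrite /x' addrAC subrr add0r.
have -> : h x' = (h x' - h x - A (x' - x)) - (A (S (h x)) - h x).
  by rewrite dx linearN opprK opprB addrACA subrr addr0 subrK.
apply: le_trans (ler_wpM2l _ (ler_normB _ _)) _ => //.
have h1 := hdiff _ _ x'r xr.
rewrite [in X in _ <= X]dx normrN in h1.
have h2 := le_trans h1 (ler_wpM2l eps0 (SC _)).
have h3 := AS (h x).
have h4 : 4 * eps * C * `|h x| <= `|h x| by rewrite ler_piMl.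
lra.
Qed.

(* By Baire, the closure of the image of some ball has interior. *)
Lemma onto_approx_inverse {R : realType} {E : normedModType R}
    {W : completeNormedModType R} (A : {linear E -> W}) :
  (forall y, exists x, A x = y) ->
  exists (C : R) (S : W -> E), [/\ 0 < C, forall y, `|S y| <= C * `|y| &
    forall y, 4 * `|A (S y) - y| <= `|y|].
Proof.
move=> onto.
pose F n := closure (A @` [set x | `|x| <= n%:R]).
have [n [y0 [r [r0 y0r]]]] : exists n y0 (r : R), 0 < r /\ ball y0 r `<=` F n.
  (* Otherwise the complements of the [F n] are open and dense; a point common to all of them would
     still have a preimage, of norm at most some [m]. *)
  apply: contrapT => nF.
  have dF n : open (~` F n) /\ dense (~` F n).
    split; first by apply: closed_openC; exact: closed_closure.
    move=> O [y0 Oy0] oO.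
    apply: contrapT => OF; apply: nF; exists n, y0.
    have /nbhs_ballP[r r0 rO] : nbhs y0 O by exact: open_nbhs_nbhs.
    exists r; split=> // y /rO Oy; apply: contrapT => Fy.
    by apply: OF; exists y.
  have [] := Baire dF (ex_intro _ 0 I : [set: W] !=set0) openT.
  move=> y [_ yF]; have [x Axy] := onto y.
  have [m xm] : exists m, `|x| <= m%:R.
    by exists (Num.truncn `|x|).+1; rewrite ltW// truncnS_gt.
  apply: (yF m) => //; apply: subset_closure; exists x => //.
have near y eta : 0 < eta -> ball y0 r y ->
    exists2 x, `|x| <= n%:R & `|A x - y| <= eta.
  move=> eta0 /y0r/(_ _ (nbhsx_ballx y _ eta0))[_ [[x xn <-]]].
  rewrite -ball_normE/= distrC => /ltW; by exists x.
have C0 : 0 < 4 * n.+1%:R / r by rewrite divr_gt0// mulr_gt0.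
suff /choice[S HS] : forall y, exists x,
    `|x| <= 4 * n.+1%:R / r * `|y| /\ 4 * `|A x - y| <= `|y|.
  by exists (4 * n.+1%:R / r), S; split=> // y; have [] := HS y.
move=> y; have [->|yn0] := eqVneq y 0.
  by exists 0; rewrite linear0 subrr !normr0 !mulr0.
have ny0 : 0 < `|y| by rewrite normr_gt0.
(* [c *: y] has norm [r / 2], so [y0 + c *: y] stays in the ball. Approximating it and [y0] within
   [c * |y| / 8], subtracting and dividing by [c] leaves an error of at most [|y| / 4] and a norm of
   at most [2 * n / c = 4 * n / r * |y|]. *)
pose c := r / (2 * `|y|).
have c0 : 0 < c by rewrite divr_gt0// mulr_gt0.
have eta0 : 0 < c * `|y| / 8 by rewrite divr_gt0// mulr_gt0.
have [|x1 x1n Ax1] := near (y0 + c *: y) _ eta0.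
  rewrite -ball_normE/= opprD addrA subrr sub0r normrN normrZ gtr0_norm//.
  by rewrite /c invfM -!mulrA mulVf ?gt_eqF// mulr1 gtr_pMr// invf_lt1// ltr1n.
have [|x2 x2n Ax2] := near y0 _ eta0; first exact: ballxx.
have cy : c * `|y| = r / 2 by rewrite /c; field; rewrite gt_eqF.
have n1 : n%:R <= n.+1%:R :> R by rewrite ler_nat.
exists (c^-1 *: (x1 - x2)); split.
  rewrite normrZ gtr0_norm ?invr_gt0// ler_pdivrMl//.
  have -> : c * (4 * n.+1%:R / r * `|y|) = (c * `|y|) * (4 * n.+1%:R / r) by ring.
  rewrite cy; have -> : r / 2 * (4 * n.+1%:R / r) = 2 * n.+1%:R :> R.
    by field; rewrite gt_eqF.
  apply: le_trans (ler_normB _ _) _; lra.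
have -> : A (c^-1 *: (x1 - x2)) - y =
    c^-1 *: ((A x1 - (y0 + c *: y)) - (A x2 - y0)).
  rewrite opprB opprD (addrC y0) addrACA (addrAC _ _ y0) addNr add0r.
  by rewrite linearZ linearB/= [RHS]scalerBr scalerA mulVf ?gt_eqF// scale1r.
rewrite normrZ gtr0_norm ?invr_gt0// mulrCA ler_pdivrMl//.
have := ler_normB (A x1 - (y0 + c *: y)) (A x2 - y0); lra.
Qed.

(** The map [A - y] has no linearization error, so [graves] with [eps = 0], started at the origin,
    reaches an exact preimage. *)
Lemma onto_bounded_preimage {R : realType} {E W : completeNormedModType R}
    (A : {linear E -> W}) :
  continuous A -> (forall y, exists x, A x = y) ->
  exists C : R, forall y, exists2 x, A x = y & `|x| <= C * `|y|.
Proof.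
move=> cA onto; have [C [S [C0 SC AS]]] := onto_approx_inverse onto.
exists (2 * C) => y.
pose h x := A x - y.
have h0 : h 0 = - y by rewrite /h linear0 sub0r.
have [|||||] := @graves _ _ _ h A S 0 C 0 (2 * C * `|y|) _ _ SC AS _ _ 0.
- by [].
- by rewrite mulr0 mul0r.
- by move=> x _; apply: cvgB; [exact: cA|exact: cvg_cst].
- by move=> x z _ _; rewrite /h opprB addrA subrK linearB subrr normr0 mul0r.
- by rewrite h0 subrr normr0 add0r normrN.
- move=> x; rewrite subr0 h0 normrN => xy /eqP.
  by rewrite subr_eq0 => /eqP; exists x.
Qed.

Lemma norming_functional {R : realType} {W : normedModType R} (y : W) :
  exists l : W -> R, [/\ forall a x z, l (a *: x + z) = a * l x + l z,
    forall x, `|l x| <= `|x| & l y = `|y|].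
Proof.
have sn : sublinear (fun x : W => `|x|).
  by split=> [x z|a x a0]; [exact: ler_normD|rewrite normrZ ger0_norm].
have [l [ll lp ly]] := hahn_banach_eq y sn; exists l; split=> // x.
by rewrite ler_norml lp andbT lerNl -linear_formN// -normrN lp.
Qed.

Lemma linear_bounded_by_continuous {R : realType} {V W : normedModType R}
    (f : {linear V -> W}) (C : R) :
  (forall x, `|f x| <= C * `|x|) -> continuous f.
Proof.
move=> fC; apply: bounded_linear_continuous; apply/linear_boundedP.
exists C; split; first exact: num_real.
by move=> r /ltW Cr x; apply: le_trans (fC x) _; exact: ler_wpM2r.
Qed.

(** * Mean value inequality and Lyusternik's theorem *)

(** A functional norming [h x - h y - A (x - y)] reduces the claim to the mean value theorem for a
    real function on the segment. *)
Lemma mean_value_ineq {R : realType} {E W : normedModType R} (h : E -> W)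
    (A : {linear E -> W}) (eps : R) (x y : E) :
  (forall t, 0 <= t <= 1 -> differentiable h (y + t *: (x - y)) /\
    `|'d h (y + t *: (x - y)) (x - y) - A (x - y)| <= eps * `|x - y|) ->
  `|h x - h y - A (x - y)| <= eps * `|x - y|.
Proof.
move=> hd; set v := x - y in hd *.
have [l [ll ln ly]] := norming_functional (h x - h y - A v).
have linl : linear (l : W -> R^o) by move=> a z w; exact: ll.
pose L : {linear W -> R^o} :=
  HB.pack (l : W -> R^o) (GRing.isLinear.Build _ _ _ _ _ linl).
have cL : continuous L.
  by apply: (@linear_bounded_by_continuous _ _ _ _ 1) => z; rewrite mul1r ln.
pose g : R^o -> E := cst y + *:%R ^~ v.
have dphi (t : R) : 0 <= t <= 1 ->
    is_diff t (L \o (h \o g)) (L \o ('d h (g t) \o (0 + *:%R ^~ v))).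
  move=> /hd[dh _]; have dg : is_diff t g (0 + *:%R ^~ v) by exact: is_diffD.
  have dhg : is_diff (g t) h ('d h (g t)) by apply/differentiableP.
  have dL : is_diff (h (g t)) L L.
    by apply: DiffDef; [exact: linear_differentiable|exact: diff_lin].
  exact: is_diff_comp.
have der (t : R) : 0 <= t <= 1 -> is_derive t 1 (L \o (h \o g)) (l ('d h (g t) v)).
  move=> /dphi dt; apply: DeriveDef; first exact/diff_derivable.
  by rewrite deriveE// diff_val/= add0r scale1r.
have [||c cI] := @MVT_segment R (L \o (h \o g)) (fun t => l ('d h (g t) v)) 0 1 ler01.
- by move=> t; rewrite in_itv/= => /andP[t0 t1]; apply: der; rewrite !ltW.
- apply: continuous_in_subspaceT => t; rewrite inE/= in_itv/= => /dphi dt.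
  exact/differentiable_continuous.
rewrite subr0 mulr1 /= /g /= !fctE scale1r scale0r addr0 addrC subrK => lc.
have -> : `|h x - h y - A v| = L ('d h (g c) v - A v).
  rewrite -ly (linearB L ('d h (g c) v) (A v)) -[L ('d h (g c) v)]lc.
  by rewrite -!(linearB L).
apply: le_trans (ler_norm _) (le_trans (ln _) _).
by move: cI; rewrite in_itv => /hd[].
Qed.

(** Near [xh] the differential is [eps]-close to ['d h xh], and balls are convex, so
    [mean_value_ineq] applies on the segment from [y] to [x]. *)
Lemma strictly_differentiable {R : realType} {E W : normedModType R}
    (h : E -> W) (xh : E) :
  (\forall x \near xh, differentiable h x) -> diff_continuous_at h xh ->
  forall eps : R, 0 < eps -> exists rho : R, [/\ 0 < rho,
    forall x, `|x - xh| <= rho -> differentiable h x &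
    forall x y, `|x - xh| <= rho -> `|y - xh| <= rho ->
      `|h x - h y - 'd h xh (x - y)| <= eps * `|x - y|].
Proof.
move=> dh cdh eps eps0.
have /nbhs_ballP[r /= r0 rP] : nbhs xh ([set x | differentiable h x] `&`
    [set x | forall v, `|'d h x v - 'd h xh v| <= eps * `|v|]).
  by apply: filterI => //; exact: cdh.
have inr x : `|x - xh| <= r / 2 -> ball xh r x.
  move=> xr; rewrite -ball_normE/= distrC; apply: le_lt_trans xr _.
  by rewrite gtr_pMr// invf_lt1// ltr1n.
exists (r / 2); split; first exact: divr_gt0.
  by move=> x /inr/rP[].
move=> x y xr yr; apply: mean_value_ineq => t /andP[t0 t1].
suff /inr/rP[dt /(_ (x - y))] : `|y + t *: (x - y) - xh| <= r / 2 by split.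
have -> : y + t *: (x - y) - xh = t *: (x - xh) + (1 - t) *: (y - xh).
  by rewrite scalerBl scale1r addrCA -scalerBr opprB addrA subrK [LHS]addrAC.
apply: le_trans (ler_normD _ _) _.
rewrite !normrZ (ger0_norm t0) ger0_norm ?subr_ge0//.
have := ler_wpM2l t0 xr.
have t1' : 0 <= 1 - t by rewrite subr_ge0.
have := ler_wpM2l t1' yr; lra.
Qed.

(** Since ['d h xh u = 0], the residual of [h] at [xh + t *: u] is [o(t)]; [graves] started there
    moves by a multiple of that residual. *)
Lemma lyusternik {R : realType} {E W : completeNormedModType R}
    (h : E -> W) (xh u : E) :
  (\forall x \near xh, differentiable h x) -> diff_continuous_at h xh ->
  (forall y, exists x, 'd h xh x = y) -> h xh = 0 -> 'd h xh u = 0 ->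
  forall e : R, 0 < e -> \forall t \near (0 : R)^'+,
    exists2 x, h x = 0 & `|x - (xh + t *: u)| <= e * t.
Proof.
move=> dh cdh onto h0 du0 e e0.
have [C [S [C0 SC AS]]] := onto_approx_inverse onto.
(* The first bound gives [4 * eps * C <= 1], the second makes the correction at most [e * t]; the
   [+ 1] covers [u = 0]. *)
pose eps := Num.min (4 * C)^-1 (e / (2 * C * (`|u| + 1))).
have u1 : 0 < `|u| + 1 by rewrite ltr_wpDl.
have eps0 : 0 < eps by rewrite lt_min invr_gt0 divr_gt0 ?mulr_gt0.
have epsC : 4 * eps * C <= 1.
  rewrite mulrAC -ler_pdivlMl ?mulr_gt0// mulr1.
  by rewrite /eps ge_min lexx.
have epsu : 2 * C * (eps * `|u|) <= e.
  have : eps <= e / (2 * C * (`|u| + 1)) by rewrite /eps ge_min lexx orbT.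
  rewrite ler_pdivlMr ?mulr_gt0// => le_e.
  apply: le_trans le_e; rewrite mulrCA ler_pM2l// ler_pM2l ?mulr_gt0//.
  by rewrite lerDl.
have [rho [rho0 rhod rhoP]] := strictly_differentiable dh cdh eps0.
have ue0 : 0 < `|u| + e by rewrite ltr_wpDl.
near=> t.
have t0 : 0 < t by near: t; exact: nbhs_right_gt.
(* Room for the displacement [t * |u|] and for the correction [e * t]. *)
have trho : t * (`|u| + e) <= rho.
  rewrite -ler_pdivlMr//; near: t; apply: nbhs_right_le.
  exact: divr_gt0.
have tu : `|xh + t *: u - xh| = t * `|u| by rewrite addrAC subrr add0r normrZ gtr0_norm.
have x0rho : `|xh + t *: u - xh| <= rho.
  rewrite tu; apply: le_trans trho; rewrite ler_pM2l// lerDl ltW//.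
have hx0 : 2 * C * `|h (xh + t *: u)| <= e * t.
  have := rhoP (xh + t *: u) xh x0rho.
  rewrite subrr normr0 => /(_ (ltW rho0)).
  rewrite tu h0 subr0 addrAC subrr add0r linearZ/= du0 scaler0 subr0 => hx.
  have C2 : 0 <= 2 * C by rewrite mulr_ge0// ltW.
  apply: le_trans (ler_wpM2l C2 hx) _.
  by have := ler_wpM2l (ltW t0) epsu; lra.
have [||x xx0 hx] := graves (ltW eps0) epsC SC AS _ rhoP (x0 := xh + t *: u).
- by move=> x /rhod; exact: differentiable_continuous.
- by rewrite tu; apply: le_trans trho; rewrite mulrDr lerD2l (mulrC t).
- by exists x => //; apply: le_trans hx0.
Unshelve. all: by end_near. Qed.

(** * Dini derivatives of Lipschitz functions *)

(** With [lower_dini_gt], this trades the lower limit for eventual bounds without division,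
    uniformly over the special case [u = 0]. *)
Lemma lower_dini_ge {R : realType} {E : normedModType R} (f : E -> R)
    (x u : E) (a : R) :
  (\forall t \near (0 : R)^'+, a * t <= f (x + t *: u) - f x) ->
  (a%:E <= lower_dini f x u)%E.
Proof.
move=> fa; rewrite /lower_dini; case: eqVneq => [u0|u0].
  near (0 : R)^'+ => t; have t0 : 0 < t by near: t; exact: nbhs_right_gt.
  have : a * t <= f (x + t *: u) - f x by near: t.
  by rewrite u0 scaler0 addr0 subrr pmulr_lle0// lee_fin.
rewrite limf_einfE; pose V := [set t | 0 < t /\ a * t <= f (x + t *: u) - f x].
have FV : (0 : R)^'+ V by apply: filterI => //; exact: nbhs_right_gt.
apply: (le_trans _ (ereal_sup_ubound (imageP _ FV))).
apply: le_ereal_inf_tmp => _ [t [t0 ft] <-].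
by rewrite lee_fin ler_pdivlMr.
Unshelve. all: by end_near. Qed.

Lemma lower_dini_gt {R : realType} {E : normedModType R} (f : E -> R)
    (x u : E) (a : R) :
  (a%:E < lower_dini f x u)%E ->
  \forall t \near (0 : R)^'+, a * t <= f (x + t *: u) - f x.
Proof.
rewrite /lower_dini; case: eqVneq => [->|u0].
  rewrite lte_fin => a0; near=> t; rewrite scaler0 addr0 subrr.
  by rewrite pmulr_lle0 ?ltW//.
rewrite limf_einfE => /ereal_sup_gt[_ [V FV <-] aV].
near=> t; have t0 : 0 < t by near: t; exact: nbhs_right_gt.
rewrite -ler_pdivlMr// -lee_fin; apply: le_trans (ltW aV) _.
apply: ereal_inf_lbound; exists t => //.
by near: t.
Unshelve. all: by end_near. Qed.

Lemma near_at_right0Z {R : realType} (c : R) (P : R -> Prop) : 0 < c ->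
  (\forall t \near (0 : R)^'+, P t) -> \forall t \near (0 : R)^'+, P (c * t).
Proof.
move=> c0 [r /= r0 rP]; near=> t.
have t0 : 0 < t by near: t; exact: nbhs_right_gt.
apply: rP => /=; last exact: mulr_gt0.
rewrite sub0r normrN gtr0_norm ?mulr_gt0// -ltr_pdivlMl//.
by near: t; apply: nbhs_right_lt; rewrite mulr_gt0// invr_gt0.
Unshelve. all: by end_near. Qed.

Lemma lipschitz_near_ge0 {R : realType} {E : normedModType R} (f : E -> R)
    (x : E) : lipschitz_near f x ->
  exists (L r : R), [/\ 0 <= L, 0 < r & forall y z, `|y - x| < r ->
    `|z - x| < r -> `|f y - f z| <= L * `|y - z|].
Proof.
move=> [V /nbhs_ballP[r r0 rV] [L LV]]; exists `|L|, r; split=> // y z yr zr.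
have Vr w : `|w - x| < r -> V w.
  by move=> wr; apply: rV; rewrite -ball_normE/= distrC.
apply: le_trans (LV y z (Vr _ yr) (Vr _ zr)) _.
by rewrite ler_wpM2r// ler_norm.
Qed.

Lemma near_right_small {R : realType} {E : normedModType R} (x u : E) (r : R) :
  0 < r -> \forall t \near (0 : R)^'+, `|x + t *: u - x| < r.
Proof.
move=> r0; near=> t.
rewrite addrAC subrr add0r normrZ.
have t0 : 0 < t by near: t; exact: nbhs_right_gt.
have u1 : 0 < `|u| + 1 by rewrite ltr_wpDl.
rewrite gtr0_norm//; apply: (@le_lt_trans _ _ (t * (`|u| + 1))).
  by rewrite ler_pM2l// lerDl.
by rewrite -ltr_pdivlMr//; near: t; apply: nbhs_right_lt; exact: divr_gt0.
Unshelve. all: by end_near. Qed.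

(** The Lipschitz bound keeps the quotients within [L * |u|] of zero, hence finite limits, and
    changing the direction by [u] moves them by at most [L * |u|]. Homogeneity is a rescaling of
    [t]. *)
Lemma lower_dini_lipschitz {R : realType} {E : normedModType R} (f : E -> R)
    (x : E) : lipschitz_near f x ->
  exists (L : R) (d : E -> R), [/\ forall u, lower_dini f x u = (d u)%:E, d 0 = 0,
    forall u w, d w - L * `|u| <= d (u + w) &
    forall c u, 0 < c -> d (c *: u) = c * d u].
Proof.
move=> /lipschitz_near_ge0[L [r [L0 r0 fL]]].
have dfin u : lower_dini f x u \is a fin_num.
  rewrite fin_numElt; apply/andP; split.
    apply: (@lt_le_trans _ _ (- (L * `|u|))%:E); first exact: ltNyr.
    apply: lower_dini_ge; near=> t.
    have t0 : 0 < t by near: t; exact: nbhs_right_gt.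
    have xr : `|x + t *: u - x| < r by near: t; exact: near_right_small.
    have := fL _ x xr; rewrite subrr normr0 => /(_ r0).
    rewrite (addrAC x) subrr add0r normrZ gtr0_norm// => /ler_normlP[+ _].
    lra.
  rewrite ltNge; apply/negP => Ly.
  have /lower_dini_gt dgt : ((L * `|u| + 1)%:E < lower_dini f x u)%E.
    by apply: lt_le_trans Ly; exact: ltry.
  near (0 : R)^'+ => t.
  have t0 : 0 < t by near: t; exact: nbhs_right_gt.
  have xr : `|x + t *: u - x| < r by near: t; exact: near_right_small.
  have : (L * `|u| + 1) * t <= f (x + t *: u) - f x by near: t.
  have := fL _ x xr; rewrite subrr normr0 => /(_ r0).
  rewrite (addrAC x) subrr add0r normrZ gtr0_norm// => /ler_normlP[_ +].
  lra.
pose d u := fine (lower_dini f x u).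
have dE u : lower_dini f x u = (d u)%:E by rewrite fineK.
have dZ c u : 0 < c -> c * d u <= d (c *: u).
  move=> c0; rewrite -ler_pdivlMl//.
  (* It is enough to test each [a] strictly below [d u], where [lower_dini_gt] applies. *)
  apply/unstable.ler_ltP => a au; rewrite ler_pdivlMl// -lee_fin -dE.
  apply: lower_dini_ge.
  have /lower_dini_gt au' : (a%:E < lower_dini f x u)%E by rewrite dE lte_fin.
  have := near_at_right0Z c0 au'; apply: filterS => t.
  by rewrite scalerA -mulrA mulrCA mulrA (mulrC t).
exists L, d; split=> //.
- by rewrite /d /lower_dini eqxx.
- move=> u w; rewrite lerBlDr; apply/unstable.ler_ltP => a aw; rewrite -lerBlDr.
  rewrite -lee_fin -dE; apply: lower_dini_ge.
  have /lower_dini_gt aw' : (a%:E < lower_dini f x w)%E by rewrite dE lte_fin.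
  near=> t.
  have t0 : 0 < t by near: t; exact: nbhs_right_gt.
  have xr : `|x + t *: w - x| < r by near: t; exact: near_right_small.
  have yr : `|x + t *: (u + w) - x| < r by near: t; exact: near_right_small.
  have : a * t <= f (x + t *: w) - f x by near: t.
  have := fL _ _ yr xr.
  rewrite scalerDr opprD addrACA subrr add0r addrK normrZ gtr0_norm//.
  move=> /ler_normlP[+ _]; lra.
- move=> c u c0; apply/eqP; rewrite eq_le dZ// andbT.
  rewrite -ler_pdivrMl//; have ci0 : 0 < c^-1 by rewrite invr_gt0.
  apply: le_trans (dZ _ _ ci0) _.
  by rewrite scalerA mulVf ?gt_eqF// scale1r.
Unshelve. all: by end_near. Qed.

(** Superadditivity comes from telescoping [d (u + v + w) - d w] through [d (v + w)], homogeneity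
    from rescaling [w], and [phi <= d] from [w = 0]. The sign is flipped to match [sublinear]. *)
Lemma mod_lower_dini_superlinear {R : realType} {E : normedModType R}
    (f : E -> R) (x : E) : lipschitz_near f x ->
  exists (L : R) (phi : E -> R), [/\ forall u, mod_lower_dini f x u = (phi u)%:E,
    sublinear (fun u => - phi u), forall u, - phi u <= L * `|u| &
    forall u, ((phi u)%:E <= lower_dini f x u)%E].
Proof.
move=> /lower_dini_lipschitz[L [d [dE d0 dL dZ]]].
pose D u := [set d (u + w) - d w | w in [set: E]].
have Dlb u : lbound (D u) (- (L * `|u|)).
  by move=> _ [w _ <-]; rewrite lerBrDl; exact: dL.
have hlb u : has_lbound (D u) by exists (- (L * `|u|)); exact: Dlb.
have D0 u : D u !=set0 by exists (d (u + 0) - d 0), 0.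
pose phi u := inf (D u).
have phi_le u w : phi u <= d (u + w) - d w by apply: ge_inf => //; exists w.
have le_phi u b : (forall w, b <= d (u + w) - d w) -> b <= phi u.
  by move=> ub; apply: lb_le_inf => // _ [w _ <-].
have phiZ c u : 0 < c -> c * phi u <= phi (c *: u).
  move=> c0; apply: le_phi => w.
  have cw : w = c *: (c^-1 *: w) by rewrite scalerA mulfV ?gt_eqF// scale1r.
  have -> : d (c *: u + w) = c * d (u + c^-1 *: w) by rewrite -dZ// scalerDr -cw.
  have -> : d w = c * d (c^-1 *: w) by rewrite -dZ// -cw.
  by rewrite -mulrBr ler_pM2l.
have phi0 : phi 0 = 0.
  apply/eqP; rewrite eq_le; apply/andP; split.
    by have := phi_le 0 0; rewrite addr0 d0 subrr.
  by apply: le_phi => w; rewrite add0r subrr.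
exists L, phi; split.
- move=> u; rewrite -ereal_inf_EFin//; congr ereal_inf.
  rewrite image_comp; apply: eq_imagel => w _ /=.
  by rewrite !dE EFinB.
- split=> [u v|c u]; first rewrite -opprD lerN2.
    apply: le_phi => w; have := phi_le u (v + w); have := phi_le v w.
    by rewrite addrA; lra.
  rewrite mulrN le_eqVlt => /predU1P[<-|c0].
    by rewrite scale0r phi0 mul0r.
  congr (- _); apply/eqP; rewrite eq_le phiZ// andbT.
  rewrite -ler_pdivrMl//; have ci0 : 0 < c^-1 by rewrite invr_gt0.
  apply: le_trans (phiZ _ _ ci0) _.
  by rewrite scalerA mulVf ?gt_eqF// scale1r.
- by move=> u; rewrite lerNl; apply: lb_le_inf.
- move=> u; rewrite dE lee_fin.
  by have := phi_le u 0; rewrite addr0 d0 subr0.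
Qed.

(** * Multipliers *)

Lemma is_dual_bounded {R : realType} {W : normedModType R} (l : W -> R) (C : R) :
  (forall a x y, l (a *: x + y) = a * l x + l y) ->
  (forall x, l x <= C * `|x|) -> is_dual l.
Proof.
move=> ll lC; split=> //.
have linl : linear (l : W -> R^o) by move=> a z w; exact: ll.
pose L : {linear W -> R^o} :=
  HB.pack (l : W -> R^o) (GRing.isLinear.Build _ _ _ _ _ linl).
apply: (@linear_bounded_by_continuous _ _ _ L C) => w.
apply/ler_normlP; split; last exact: lC.
by rewrite -(linearN L) -normrN; exact: lC.
Qed.

(* Hahn-Banach in the product of [W] and the criterion space, applied to
   [p (w, y) = inf {r | exists u, A u = w and y_i - phi_i u <= r for i in P}]:
   the components of a linear minorant of [p] are the multipliers. *)
Lemma superlinear_multipliers {R : realType} {E W : normedModType R} {n : nat}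
    (A : {linear E -> W}) (C L : R) (P : pred 'I_n) (phi : 'I_n -> E -> R) :
  (forall y, exists2 x, A x = y & `|x| <= C * `|y|) ->
  (forall i, sublinear (fun u => - phi i u)) ->
  (forall i u, - phi i u <= L * `|u|) ->
  (forall u, A u = 0 -> exists2 i, P i & phi i u <= 0) ->
  exists (lam : 'I_n -> R) (w0 : W -> R),
    [/\ forall i, 0 <= lam i, is_dual w0, forall i, ~~ P i -> lam i = 0,
      exists i, lam i != 0 &
      forall u, \sum_(i < n) lam i * phi i u + w0 (A u) <= 0].
Proof.
move=> AC subphi phiL nosol.
pose V : lmodType R := (W * 'rV[R]_n)%type.
pose G (v : V) := [set r | exists2 u, A u = v.1 &
  forall i, P i -> v.2 0 i - phi i u <= r].
have [i0 Pi0 _] := nosol 0 (linear0 A).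
have subphiD i u v : phi i u + phi i v <= phi i (u + v).
  by have := (subphi i).1 u v; lra.
have G_ge (u : E) (y : 'rV[R]_n) (c : R) :
    (forall i, P i -> y 0 i - phi i u <= c) -> G (A u, y) c.
  by exists u.
have G0 v : G v !=set0.
  case: v => w y; have [u Auw _] := AC w.
  exists (\sum_(i < n) `|y 0 i - phi i u|); exists u => // i _.
  rewrite (bigD1 i)//=; apply: le_trans (ler_norm _) _.
  by rewrite lerDl sumr_ge0.
(* Here [nosol] enters: subtracting a fixed preimage [u0] lands in the kernel, so some [i] has
   [phi i u + phi i (- u0) <= 0]. This [i] varies with [u], hence the sum over all indices. *)
have Glb v : has_lbound (G v).
  case: v => w y; have [u0 Au0 _] := AC w.
  exists (- \sum_(i < n) `|y 0 i + phi i (- u0)|) => r [u /= Auw yr].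
  have /nosol[i Pi phii] : A (u - u0) = 0 by rewrite linearB Auw Au0 subrr.
  have := yr i Pi; have := subphiD i u (- u0).
  have : `|y 0 i + phi i (- u0)| <= \sum_(j < n) `|y 0 j + phi j (- u0)|.
    by rewrite (bigD1 i)//= lerDl sumr_ge0.
  by have := ler_norm (- (y 0 i + phi i (- u0))); rewrite normrN; lra.
have sub_p : sublinear (fun v : V => inf (G v)).
  apply: sublinear_inf => //.
  - move=> [w1 y1] [w2 y2] r s [u1 /= A1 P1] [u2 /= A2 P2].
    exists (r + s) => //; exists (u1 + u2); first by rewrite linearD A1 A2.
    move=> i Pi /=; rewrite mxE.
    by have := P1 i Pi; have := P2 i Pi; have := subphiD i u1 u2; lra.
  - move=> a [w y] r a0 [u /= Au Pu]; exists (a * r) => //.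
    exists (a *: u); first by rewrite linearZ Au.
    move=> i Pi /=; rewrite mxE.
    have := (subphi i).2 a u (ltW a0); have := ler_wpM2l (ltW a0) (Pu i Pi).
    lra.
  - exists 0 => //; exists 0; first exact: linear0.
    move=> i Pi /=; rewrite mxE.
    by have := sublinear0 (subphi i) => /eqP; rewrite oppr_eq0 => /eqP ->; rewrite subr0.
have [l [ll lp]] := hahn_banach sub_p.
have l_le v r : G v r -> l v <= r.
  by move=> Gr; apply: le_trans (lp v) _; exact: ge_inf.
have phi0 i : phi i 0 = 0.
  by have := sublinear0 (subphi i) => /eqP; rewrite oppr_eq0 => /eqP.
have lD v1 v2 : l (v1 + v2) = l v1 + l v2.
  by rewrite -{1}(scale1r v1) ll mul1r.
have l0 := linear_form0 ll.
have lZ a v : l (a *: v) = a * l v by rewrite -[a *: v]addr0 ll l0 addr0.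
pose lam i := l (0, delta_mx 0 i); pose w0 w := l (w, 0).
have lamE i a : a * lam i = l (0, a *: delta_mx 0 i).
  by rewrite -lZ; congr l; congr pair; rewrite scaler0.
have l0y (y : 'rV[R]_n) : l (0, y) = \sum_(i < n) y 0 i * lam i.
  rewrite [in LHS](row_sum_delta y).
  apply: (big_ind2 (fun (y : 'rV[R]_n) s => l (0, y) = s)).
  - exact: l0.
  - by move=> y1 _ y2 _ <- <-; rewrite -lD; congr l; congr pair; rewrite addr0.
  - by move=> i _; rewrite lamE.
have lE w (y : 'rV[R]_n) : l (w, y) = w0 w + \sum_(i < n) y 0 i * lam i.
  by rewrite -l0y -lD; congr l; congr pair; rewrite ?addr0 ?add0r.
have G00 (y : 'rV[R]_n) c : (forall i, P i -> y 0 i <= c) -> G (0, y) c.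
  move=> yc; rewrite -(linear0 A); apply: G_ge => i Pi.
  by rewrite phi0 subr0; exact: yc.
exists lam, w0; split.
(* At [(0, - delta_mx 0 i)] the choice [u = 0] shows [p <= 0]. *)
- move=> i; rewrite -oppr_le0 -mulN1r lamE; apply/l_le/G00 => j _.
  by rewrite !mxE mulN1r oppr_le0 /= ler0n.
(* A preimage [u] of [z] with [|u| <= C * |z|] bounds [p (z, 0)] by [|L| * C * |z|]. *)
- apply: (@is_dual_bounded _ _ _ (`|L| * C)) => [a x y|z].
    by rewrite /w0 -ll; congr l; congr pair; rewrite /= scaler0 addr0.
  apply: l_le; have [u <- uC] := AC z; apply: G_ge => i _.
  rewrite mxE sub0r; apply: le_trans (phiL i u) _.
  apply: le_trans (ler_wpM2r _ (ler_norm L)) _ => //.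
  by rewrite -mulrA ler_wpM2l.
(* Coordinates outside [P] do not enter [p], so both signs of [delta_mx 0 i] give [p <= 0]. *)
- move=> i nPi; apply/eqP; rewrite eq_le; apply/andP; split.
    apply/l_le/G00 => j Pj; rewrite mxE.
    by case: (eqVneq j i) Pj nPi => [-> ->|].
  rewrite -oppr_le0 -mulN1r lamE; apply/l_le/G00 => j Pj; rewrite !mxE.
  by case: (eqVneq j i) Pj nPi => [-> ->|_ _ _]; rewrite ?mulr0.
(* At [w = 0] and [y = (-1, ..., -1)] one has [p <= -1], impossible for [l] if every [lam i]
   vanishes. *)
- apply: contrapT => nlam.
  have lam0 i : lam i = 0 by apply/eqP/negP => /negP li; apply: nlam; exists i.
  have : l (0, const_mx (-1)) <= -1 by apply/l_le/G00 => j _; rewrite mxE.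
  rewrite l0y big1 => [|i _]; last by rewrite lam0 mulr0.
  by rewrite lerNr oppr0 ler10.
(* The vector [u] itself shows [p <= 0] at [(A u, phi u)]. *)
- move=> u; have : l (A u, \row_i phi i u) <= 0.
    by apply/l_le/G_ge => i _; rewrite mxE subrr.
  rewrite lE addrC; under eq_bigr do rewrite mxE mulrC.
  by [].
Qed.
(** The sublinear functional is the distance to the range: a minorant vanishes on the range, and one
    touching it at [y] is positive there because the range is closed. *)
Lemma closed_range_annihilator {R : realType} {E W : normedModType R}
    (A : {linear E -> W}) :
  closed (range A) -> ~ (forall y, exists u, A u = y) ->
  exists w0 : W -> R,
    [/\ is_dual w0, forall u, w0 (A u) = 0 & exists y, w0 y <> 0].
Proof.
move=> clA /existsNP[y yA].
pose G w := [set `|w - A u| | u in [set: E]].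
have Glb w : has_lbound (G w) by exists 0 => _ [u _ <-].
have sub_p : sublinear (fun w => inf (G w)).
  apply: sublinear_inf => //.
  - by move=> w; exists `|w - A 0|, 0.
  - move=> w1 w2 _ _ [u1 _ <-] [u2 _ <-].
    exists `|w1 + w2 - A (u1 + u2)|; first by exists (u1 + u2).
    by rewrite linearD opprD addrACA ler_normD.
  - move=> a w _ a0 [u _ <-]; exists `|a *: w - A (a *: u)|.
      by exists (a *: u).
    by rewrite linearZ -scalerBr normrZ gtr0_norm.
  - by exists `|0 - A 0|; [exists 0|rewrite linear0 subrr normr0].
have [l [ll lp ly]] := hahn_banach_eq y sub_p.
have l_le w u : l w <= `|w - A u|.
  by apply: le_trans (lp w) _; apply: ge_inf => //; exists u.
have dl : is_dual l.
  apply: (@is_dual_bounded _ _ _ 1) => // w.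
  by apply: le_trans (l_le w 0) _; rewrite linear0 subr0 mul1r.
exists l; split=> //.
  move=> u; have lA v : l (A v) <= 0.
    by apply: le_trans (l_le _ v) _; rewrite subrr normr0.
  by apply/eqP; rewrite eq_le lA /= -oppr_le0 -linear_formN// -linearN.
exists y; rewrite ly; apply/eqP; rewrite gt_eqF//.
have /nbhs_ballP[r /= r0 rA] : nbhs y (~` range A).
  apply: open_nbhs_nbhs; split; first exact: closed_openC.
  by case=> u _ Au; apply: yA; exists u.
apply: lt_le_trans r0 _; apply: lb_le_inf; first by exists `|y - A 0|, 0.
move=> _ [u _ <-]; rewrite leNgt; apply/negP => yu.
by apply: (rA (A u)); [rewrite -ball_normE|exists u].
Qed.

(** * Optimality excludes first-order ascent in the kernel *)

Lemma near_ray {R : realType} {E : normedModType R} (x u : E) (N : set E) (e : R) :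
  nbhs x N -> \forall t \near (0 : R)^'+, forall z, `|z - (x + t *: u)| <= e * t -> N z.
Proof.
move=> /nbhs_ballP[r /= r0 rN]; have r2 : 0 < r / 2 by exact: divr_gt0.
have e1 : 0 < `|e| + 1 by rewrite ltr_wpDl.
near=> t => z zt; apply: rN.
have t0 : 0 < t by near: t; exact: nbhs_right_gt.
have xt : `|x + t *: u - x| < r / 2 by near: t; exact: near_right_small.
have et : t < r / 2 / (`|e| + 1).
  by near: t; apply: nbhs_right_lt; exact: divr_gt0.
rewrite ltr_pdivlMr// in et.
rewrite -ball_normE/= distrC -(subrK (x + t *: u) z) -addrA.
apply: le_lt_trans (ler_normD _ _) _.
have := ler_wpM2l (ltW t0) (ler_norm e); lra.
Unshelve. all: by end_near. Qed.

Lemma lipschitz_near_gt0 {R : realType} {E : normedModType R} (f : E -> R)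
    (x : E) : lipschitz_near f x -> 0 < f x -> \forall z \near x, 0 < f z.
Proof.
move=> /lipschitz_near_ge0[L [r [L0 r0 fL]]] fx0.
have L1 : 0 < L + 1 by rewrite ltr_wpDl.
apply/nbhs_ballP; exists (Num.min r (f x / (L + 1))).
  by rewrite /= lt_min r0 divr_gt0.
move=> z; rewrite -ball_normE/= lt_min distrC => /andP[zr].
rewrite ltr_pdivlMr// => zf.
have := fL z x zr; rewrite subrr normr0 => /(_ r0) /ler_normlP[fz _].
have := normr_ge0 (z - x); lra.
Qed.

(** Along the ray [f] gains at least [d u / 2 * t]; leaving it by [e * t] costs at most [L * e * t],
    less than the gain for small [e]. Choosing [e] before [t] lets several functions share it and
    matches [lyusternik]. *)
Lemma lower_dini_ascent {R : realType} {E : normedModType R} (f : E -> R)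
    (x u : E) : lipschitz_near f x -> (0 < lower_dini f x u)%E ->
  \forall e \near (0 : R)^'+, \forall t \near (0 : R)^'+,
    forall z, `|z - (x + t *: u)| <= e * t -> f x < f z.
Proof.
move=> fl; have [_ [d [dE _ _ _]]] := lower_dini_lipschitz fl.
have [L [r [L0 r0 fL]]] := lipschitz_near_ge0 fl.
rewrite dE lte_fin => d0; have L1 : 0 < L + 1 by rewrite ltr_wpDl.
have a0 : 0 < d u / 2 by exact: divr_gt0.
have /lower_dini_gt fa : ((d u / 2)%:E < lower_dini f x u)%E.
  by rewrite dE lte_fin gtr_pMr// invf_lt1// ltr1n.
near=> e; have e0 : 0 < e by near: e; exact: nbhs_right_gt.
have eL : e < d u / 2 / (L + 1) by near: e; apply: nbhs_right_lt; exact: divr_gt0.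
rewrite ltr_pdivlMr// in eL.
near=> t => z zt; have t0 : 0 < t by near: t; exact: nbhs_right_gt.
have xr : `|x + t *: u - x| < r by near: t; exact: near_right_small.
have zr : `|z - x| < r.
  move: z zt; near: t; apply: (@near_ray _ _ _ _ [set z | `|z - x| < r]).
  apply/nbhs_ballP; exists r => // z.
  by rewrite -ball_normE/= distrC.
have fat : d u / 2 * t <= f (x + t *: u) - f x by near: t.
have /ler_normlP[fz _] := fL z _ zr xr.
have := ler_wpM2l L0 zt; have : e * (L + 1) * t < d u / 2 * t by rewrite ltr_pM2r.
have : 0 < e * t by exact: mulr_gt0.
lra.
Unshelve. all: by end_near. Qed.

Lemma no_feasible_ascent {R : realType} {E W : completeNormedModType R}
    {Omega : set E} {m : nat} {f : 'I_m.+1 -> E -> R} {h : E -> W} {xh u : E} :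
  open Omega -> Omega xh -> (forall i : 'I_m.+1, i != ord0 -> 0 <= f i xh) ->
  h xh = 0 ->
  (forall x, Omega x -> (forall i : 'I_m.+1, i != ord0 -> 0 <= f i x) ->
     h x = 0 -> f ord0 x <= f ord0 xh) ->
  (forall i, lipschitz_near (f i) xh) ->
  (\forall x \near xh, differentiable h x) -> diff_continuous_at h xh ->
  (forall y, exists x, 'd h xh x = y) -> 'd h xh u = 0 ->
  ~ forall i : 'I_m.+1, (i == ord0) || (f i xh == 0) ->
      (0 < lower_dini (f i) xh u)%E.
Proof.
move=> openO Ox fge0 hx0 opt lipf dh cdh onto du0 asc.
(* Strict increase for the objective and the active constraints, mere positivity for the inactive
   ones. *)
pose Q (i : 'I_m.+1) z := if (i == ord0) || (f i xh == 0)
  then f i xh < f i z else 0 < f i z.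
have nearQ : \forall e \near (0 : R)^'+, \forall t \near (0 : R)^'+,
    forall i z, `|z - (xh + t *: u)| <= e * t -> Q i z.
  have nearQi i : \forall e \near (0 : R)^'+, \forall t \near (0 : R)^'+,
      forall z, `|z - (xh + t *: u)| <= e * t -> Q i z.
    rewrite /Q; case: (boolP ((i == ord0) || (f i xh == 0))) => [Pi|].
      exact: lower_dini_ascent (lipf i) (asc i Pi).
    rewrite negb_or => /andP[iN0 fiN0]; apply: nearW => e; apply: near_ray.
    by apply: lipschitz_near_gt0 => //; rewrite lt_def fiN0 fge0.
  (* Finitely many indices share one [e] and one range of [t]. *)
  near=> e; apply: filter_forall; near: e.
  exact: filter_forall nearQi.
have [e [e0 eQ]] := filter_ex (filterI (F := (0 : R)^'+) (nbhs_right_gt 0) nearQ).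
have nearO := near_ray u e (open_nbhs_nbhs (conj openO Ox)).
have lyu := lyusternik dh cdh onto hx0 du0 e0.
have [t [[tQ tO] [x hx xt]]] := 
  filter_ex (filterI (F := (0 : R)^'+) (filterI (F := (0 : R)^'+) eQ nearO) lyu).
have Qx i : Q i x by exact: tQ.
have := Qx ord0; rewrite /Q eqxx/= ltNge => /negP; apply.
apply: opt => //; first exact: tO.
move=> i iN0; have := Qx i; rewrite /Q (negbTE iN0)/=.
by case: eqVneq => [->|_] /ltW.
Unshelve. all: by end_near. Qed.

Theorem theorem4p1 (R : realType) (E W : completeNormedModType R)
  (Omega : set E) (m : nat) (f : 'I_m.+1 -> E -> R) (h : E -> W) (xh : E) :
  open Omega ->
  (* xh solves (H1) *)
  Omega xh -> (forall i : 'I_m.+1, i != ord0 -> 0 <= f i xh) -> h xh = 0 ->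
  (forall x, Omega x -> (forall i : 'I_m.+1, i != ord0 -> 0 <= f i x) ->
     h x = 0 -> f ord0 x <= f ord0 xh) ->
  (* (a) *)
  (forall i, lipschitz_near (f i) xh) ->
  (* (b) *)
  (\forall x \near xh, differentiable h x) ->
  diff_continuous_at h xh ->
  closed (range ('d h xh)) ->
  (* (c) *)
  complemented [set u | 'd h xh u = 0] ->
  exists (lam : 'I_m.+1 -> R) (w0 : W -> R),
    [/\ (forall i, 0 <= lam i), is_dual w0,
      (* (i) *)
      ~ ((forall i, lam i = 0) /\ (forall y, w0 y = 0)),
      (* (ii) *)
      (forall i : 'I_m.+1, i != ord0 -> lam i * f i xh = 0) &
      (* (iii) *) [/\ (forall u : E, (\sum_(i < m.+1) (lam i)%:E * mod_lower_dini (f i) xh u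
                      + (w0 ('d h xh u))%:E <= 0)%E),
      (* moreover: not onto *)
      (~ (forall y : W, exists u, 'd h xh u = y) ->
         (forall i, lam i = 0) /\ exists y, w0 y <> 0) &
      (* moreover: onto *)
      ((forall y : W, exists u, 'd h xh u = y) ->
         (exists i, lam i <> 0) /\
         ((exists w : E, 'd h xh w = 0 /\
             forall j : 'I_m.+1, j != ord0 -> f j xh = 0 ->
               (0 < mod_lower_dini (f j) xh w)%E) ->
          lam ord0 = 1))]].
Proof.
move=> openO Ox fge0 hx0 opt lipf dh cdh clA _.
have dhx : differentiable h xh := nbhs_singleton dh.
have [onto|nonto] := pselect (forall y : W, exists u, 'd h xh u = y); last first.
  have [w0 [dw0 w0A [y w0y]]] := closed_range_annihilator clA nonto.
  exists (fun=> 0), w0; split=> //.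
  - by move=> [_ /(_ y)].
  - by move=> i _; rewrite mul0r.
  split=> //; last by split=> //; exists y.
  by move=> u; rewrite w0A adde0 big1// => i _; rewrite mul0e.
have /choice[L /choice[phi Hphi]] i := mod_lower_dini_superlinear (lipf i).
have phiE i u : mod_lower_dini (f i) xh u = (phi i u)%:E by have [] := Hphi i.
have [C AC] := onto_bounded_preimage (diff_continuous dhx) onto.
(* The objective and the active constraints; multipliers vanishing off [P] give complementary
   slackness. *)
pose P (i : 'I_m.+1) := (i == ord0) || (f i xh == 0).
have nosol u : 'd h xh u = 0 -> exists2 i, P i & phi i u <= 0.
  move=> du0; apply: contrapT => nex.
  apply: (no_feasible_ascent openO Ox fge0 hx0 opt lipf dh cdh onto du0) => i Pi.
  have [_ _ _ /(_ u)] := Hphi i; apply: lt_le_trans.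
  by rewrite lte_fin ltNge; apply/negP => phi0; apply: nex; exists i.
have phiL i u : - phi i u <= (\sum_i `|L i|) * `|u|.
  have [_ _ /(_ u) phiu _] := Hphi i; apply: le_trans phiu _.
  rewrite ler_wpM2r// (bigD1 i)//=; apply: le_trans (ler_norm _) _.
  by rewrite lerDl sumr_ge0.
have subphi i : sublinear (fun u => - phi i u) by have [] := Hphi i.
have [lam [w0 [lam0 dw0 lamP [i1 lam1] lamle]]] :=
  superlinear_multipliers AC subphi phiL nosol.
have w00 : w0 0 = 0 := linear_form0 dw0.1.
pose regular := exists w : E, 'd h xh w = 0 /\ forall j : 'I_m.+1, j != ord0 ->
  f j xh = 0 -> (0 < mod_lower_dini (f j) xh w)%E.
(* If [lam ord0] vanished, the nonzero [lam i1] would belong to an active constraint, making the sum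
   at [w] positive while [w0 ('d h xh w) = 0]. *)
have lam_ord0 : regular -> 0 < lam ord0.
  move=> [w [dw0' wP]]; rewrite lt_def lam0 andbT; apply/negP => /eqP lam00.
  have term_ge0 i : 0 <= lam i * phi i w.
    have [->|iN0] := eqVneq i ord0; first by rewrite lam00 mul0r.
    have [fi0|fiN0] := eqVneq (f i xh) 0.
      by have := wP i iN0 fi0; rewrite phiE lte_fin => /ltW; exact: mulr_ge0.
    by rewrite lamP ?mul0r// negb_or iN0.
  have i1N0 : i1 != ord0 by apply: contra_neq lam1 => ->.
  have phi1 : 0 < phi i1 w.
    have := wP i1 i1N0; rewrite phiE lte_fin; apply.
    by apply/eqP; apply: contraNT lam1 => fi1; rewrite lamP// negb_or i1N0.
  have lam1_gt0 : 0 < lam i1 by rewrite lt_def lam1 lam0.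
  have := lamle w; rewrite dw0' w00 addr0 (bigD1 i1)//=; apply/negP.
  by rewrite -ltNge ltr_wpDr ?sumr_ge0// mulr_gt0.
(* Rescaling by a positive factor normalizes [lam ord0] in the regular case and preserves every
   other conclusion, so one family serves for all claims. *)
have [c [c0 cP]] : exists c : R, 0 < c /\ (regular -> c * lam ord0 = 1).
  have [/lam_ord0 l0|//] := pselect regular; last by exists 1.
  by exists (lam ord0)^-1; rewrite invr_gt0 mulVf ?gt_eqF.
exists (fun i => c * lam i), (fun y => c * w0 y); split.
- by move=> i; rewrite mulr_ge0// ltW.
- split=> [a x y|x]; first by rewrite dw0.1; ring.
  by apply: cvgM; [exact: cvg_cst|exact: dw0.2].
- by move=> [/(_ i1)/eqP + _]; rewrite mulf_eq0 gt_eqF//= (negbTE lam1).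
- move=> i iN0; have [->|fiN0] := eqVneq (f i xh) 0; first by rewrite mulr0.
  by rewrite lamP ?mulr0 ?mul0r// negb_or iN0.
split=> //.
- move=> u; under eq_bigr do rewrite phiE -EFinM -mulrA.
  rewrite sumEFin -EFinD -mulr_sumr -mulrDr lee_fin.
  by rewrite pmulr_rle0.
- by move=> _; split; [exists i1; apply/eqP; rewrite mulf_neq0// gt_eqF|exact: cP].
Qed.
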